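(* Let $G$ be a group and let $R$ be a $G$-graded ring. If $(R,G)$ is regular, then $(R,G)$ is weak.
   Context: A ring $R$ with unity $1$ is $G$-graded if $R=\bigoplus_{g\in G}R_g$ for additive subgroups $R_g$ with $R_gR_h\subseteq R_{gh}$ for all $g,h\in G$. $(R,G)$ is regular if for all $g\in G$ and all $a_g\in R_g\setminus\{0\}$ we have $a_g\in a_gR_{g^{-1}}a_g$. $(R,G)$ is weak if for every $g\in G$, $R_g=\{0\}$ implies $R_{g^{-1}}=\{0\}$. *)

(* Defs.v *)
From mathcomp Require Import all_boot all_algebra.
From mathcomp Require Import boolp classical_sets cardinality fsbigop.

Set Implicit Arguments.
Unset Strict Implicit.
Unset Printing Implicit Defensive.

Import GRing.Theory.

Local Open Scope classical_set_scope.
Local Open Scope ring_scope.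

(* The direct sum is internal: every x is the sum of exactly one finitely
   supported family of components.  The finiteness requirement is essential,
   since the sum over [set: G] is 0 by convention on infinite supports. *)
Record is_grading (G : groupType) (R : pzRingType) (R_ : G -> set R) : Prop :=
  IsGrading {
    grading_subgroup : forall g : G, zmod_closed (mem (R_ g));
    grading_direct_sum : forall x : R, exists! f : G -> R,
      [/\ forall g : G, R_ g (f g),
          finite_set [set g : G | f g != 0]
        & x = \sum_(g \in [set: G]) f g];
    grading_mul : forall (g h : G) (a b : R),
      R_ g a -> R_ h b -> R_ (g * h)%g (a * b)
  }.

Definition graded_regular (G : groupType) (R : pzRingType) (R_ : G -> set R) :
    Prop :=
  forall (g : G) (a : R), (R_ g `\ 0) a -> [set a * b * a | b in R_ (g^-1)%g] a.

Definition graded_weak (G : groupType) (R : pzRingType) (R_ : G -> set R) :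
    Prop :=
  forall g : G, R_ g = [set 0] -> R_ (g^-1)%g = [set 0].

(* Main.v *)
Require Import Defs.
From mathcomp Require Import all_boot all_algebra.
From mathcomp Require Import boolp classical_sets cardinality fsbigop.

(** Regularity gives a nonzero [a] of degree [g^-1] an inner inverse [b] of the inverse degree,
    which is [g] again. If that component is zero then [b = 0], so [a = a * b * a] vanishes, a
    contradiction. *)

Theorem corollary2p8 (G : groupType) (R : pzRingType) (R_ : G -> set R) :
  is_grading R_ -> graded_regular R_ -> graded_weak R_.
Proof.
move=> gradR regR g Rg0; apply/seteqP; split=> [a Ra | _ ->].
  apply: contrapT => a_neq0.
  have [b] := regR _ a (conj Ra a_neq0).
  rewrite invgK Rg0 => -> aba; apply: a_neq0.
  by rewrite /= -aba GRing.mulr0 GRing.mul0r.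
(* Conversely, 0 lies in the component of [g^-1] because it is an additive subgroup; regularity only
   bounds the component from above. *)
by have [/set_mem] := grading_subgroup gradR (g^-1)%g.
Qed.
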